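(* Let $\mathbf{G3X}$ be any one of the calculi $\mathbf{G3E}$, $\mathbf{G3EN}$, $\mathbf{G3M}$, $\mathbf{G3MN}$, $\mathbf{G3C}$, $\mathbf{G3CN}$, $\mathbf{G3R}$, $\mathbf{G3K}$, $\mathbf{G3ED^\bot}$, $\mathbf{G3END^\bot}$, $\mathbf{G3ED^\Diamond}$, $\mathbf{G3ED}$, $\mathbf{G3END}$, $\mathbf{G3MD^\bot}$, $\mathbf{G3MND^\bot}$, $\mathbf{G3MD}$, $\mathbf{G3MND}$, $\mathbf{G3CD^\Diamond}$, $\mathbf{G3CD}$, $\mathbf{G3CND}$, $\mathbf{G3RD}$, $\mathbf{G3KD}$. The cut rule is admissible in $\mathbf{G3X}$: for all formulas $D$ and finite multisets $\Gamma,\Delta,\Pi,\Sigma$, if $\Gamma\Rightarrow\Delta,D$ and $D,\Pi\Rightarrow\Sigma$ are derivable in $\mathbf{G3X}$, then $\Gamma,\Pi\Rightarrow\Delta,\Sigma$ is derivable in $\mathbf{G3X}$.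
   Context: Formulas are generated from countably many propositional variables $p_0,p_1,\dots$ and the $0$-ary constant $\bot$ by the binary connectives $\wedge,\vee,\supset$ and the unary operator $\Box$; $\neg A:=A\supset\bot$, $\top:=\bot\supset\bot$, $\Diamond A:=\neg\Box\neg A$. A sequent is an expression $\Gamma\Rightarrow\Delta$ with $\Gamma,\Delta$ finite, possibly empty, multisets of formulas; if $\Pi=A_1,\dots,A_m$ then $\Box\Pi=\Box A_1,\dots,\Box A_m$. The calculus $\mathbf{G3cp}$ has initial sequents $p,\Gamma\Rightarrow\Delta,p$ ($p$ a propositional variable), the zero-premiss rule $L\bot$ with conclusion $\bot,\Gamma\Rightarrow\Delta$, and the rules (premisses / conclusion): $L\wedge$: $A,B,\Gamma\Rightarrow\Delta$ / $A\wedge B,\Gamma\Rightarrow\Delta$; $R\wedge$: $\Gamma\Rightarrow\Delta,A$ and $\Gamma\Rightarrow\Delta,B$ / $\Gamma\Rightarrow\Delta,A\wedge B$; $L\vee$: $A,\Gamma\Rightarrow\Delta$ and $B,\Gamma\Rightarrow\Delta$ / $A\vee B,\Gamma\Rightarrow\Delta$; $R\vee$: $\Gamma\Rightarrow\Delta,A,B$ / $\Gamma\Rightarrow\Delta,A\vee B$; $L\supset$: $\Gamma\Rightarrow\Delta,A$ and $B,\Gamma\Rightarrow\Delta$ / $A\supset B,\Gamma\Rightarrow\Delta$; $R\supset$: $A,\Gamma\Rightarrow\Delta,B$ / $\Gamma\Rightarrow\Delta,A\supset B$. Modal and deontic rules ($\Gamma,\Delta$ arbitrary multisets): $LR$-$E$: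 $A\Rightarrow B$ and $B\Rightarrow A$ / $\Box A,\Gamma\Rightarrow\Delta,\Box B$; $LR$-$M$: $A\Rightarrow B$ / $\Box A,\Gamma\Rightarrow\Delta,\Box B$; $LR$-$R$: $A,\Pi\Rightarrow B$ / $\Box A,\Box\Pi,\Gamma\Rightarrow\Delta,\Box B$; $LR$-$C$ (for each $n\ge1$): $A_1,\dots,A_n\Rightarrow B$ and $B\Rightarrow A_1$, …, $B\Rightarrow A_n$ / $\Box A_1,\dots,\Box A_n,\Gamma\Rightarrow\Delta,\Box B$; $LR$-$K$: $\Pi\Rightarrow B$ / $\Box\Pi,\Gamma\Rightarrow\Delta,\Box B$; $R$-$N$: $\Rightarrow B$ / $\Gamma\Rightarrow\Delta,\Box B$; $L$-$D^\bot$: $A\Rightarrow$ / $\Box A,\Gamma\Rightarrow\Delta$; $L$-$D^{\Diamond_E}$ ($|\Pi|\le2$): $\Pi\Rightarrow$ and $\Rightarrow\Pi$ / $\Box\Pi,\Gamma\Rightarrow\Delta$; $L$-$D^{\Diamond_M}$ ($|\Pi|\le2$): $\Pi\Rightarrow$ / $\Box\Pi,\Gamma\Rightarrow\Delta$; $L$-$D^{\Diamond_C}$: $\Pi,\Sigma\Rightarrow$ and $\Rightarrow A,B$ for every $A\in\Pi$, $B\in\Sigma$ / $\Box\Pi,\Box\Sigma,\Gamma\Rightarrow\Delta$; $L$-$D^*$: $\Pi\Rightarrow$ / $\Box\Pi,\Gamma\Rightarrow\Delta$. Each calculus is $\mathbf{G3cp}$ plus: $\mathbf{G3E}$: $LR$-$E$;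 $\mathbf{G3EN}$: $LR$-$E$, $R$-$N$; $\mathbf{G3M}$: $LR$-$M$; $\mathbf{G3MN}$: $LR$-$M$, $R$-$N$; $\mathbf{G3C}$: $LR$-$C$; $\mathbf{G3CN}$: $LR$-$C$, $R$-$N$; $\mathbf{G3R}$: $LR$-$R$; $\mathbf{G3K}$: $LR$-$K$; $\mathbf{G3ED^\bot}$ / $\mathbf{G3END^\bot}$: rules of $\mathbf{G3E}$ / $\mathbf{G3EN}$ plus $L$-$D^\bot$; $\mathbf{G3ED^\Diamond}$: rules of $\mathbf{G3E}$ plus $L$-$D^{\Diamond_E}$; $\mathbf{G3ED}$ / $\mathbf{G3END}$: rules of $\mathbf{G3E}$ / $\mathbf{G3EN}$ plus $L$-$D^\bot$ and $L$-$D^{\Diamond_E}$; $\mathbf{G3MD^\bot}$ / $\mathbf{G3MND^\bot}$: rules of $\mathbf{G3M}$ / $\mathbf{G3MN}$ plus $L$-$D^\bot$; $\mathbf{G3MD}$ / $\mathbf{G3MND}$: rules of $\mathbf{G3M}$ / $\mathbf{G3MN}$ plus $L$-$D^{\Diamond_M}$; $\mathbf{G3CD^\Diamond}$: rules of $\mathbf{G3C}$ plus $L$-$D^{\Diamond_C}$; $\mathbf{G3CD}$, $\mathbf{G3CND}$, $\mathbf{G3RD}$, $\mathbf{G3KD}$: rules of $\mathbf{G3C}$, $\mathbf{G3CN}$, $\mathbf{G3R}$, $\mathbf{G3K}$ respectively plus $L$-$D^*$. A derivation is a finite upward-growing tree of sequents whose leaves are initial sequents or conclusions of $L\bot$ and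 each other node is the conclusion of a rule instance whose premisses are its children. *)

(* Defs.v *)
From HB Require Import structures.
From mathcomp Require Import all_boot.
From mathcomp Require Import finmap multiset.

Set Implicit Arguments.
Unset Strict Implicit.
Unset Printing Implicit Defensive.

Local Open Scope mset_scope.

Inductive formula : Type :=
  | Var of nat
  | Bot
  | And of formula & formula
  | Or of formula & formula
  | Imp of formula & formula
  | Box of formula.

Fixpoint formula_to_tree (A : formula) : GenTree.tree nat :=
  match A with
  | Var n => GenTree.Leaf n
  | Bot => GenTree.Node 0 [::]
  | And A1 A2 => GenTree.Node 1 [:: formula_to_tree A1; formula_to_tree A2]
  | Or A1 A2 => GenTree.Node 2 [:: formula_to_tree A1; formula_to_tree A2]
  | Imp A1 A2 => GenTree.Node 3 [:: formula_to_tree A1; formula_to_tree A2]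
  | Box A1 => GenTree.Node 4 [:: formula_to_tree A1]
  end.

Fixpoint formula_of_tree (t : GenTree.tree nat) : option formula :=
  match t with
  | GenTree.Leaf n => Some (Var n)
  | GenTree.Node 0 [::] => Some Bot
  | GenTree.Node 1 [:: t1; t2] =>
      if (formula_of_tree t1, formula_of_tree t2) is (Some A1, Some A2)
      then Some (And A1 A2) else None
  | GenTree.Node 2 [:: t1; t2] =>
      if (formula_of_tree t1, formula_of_tree t2) is (Some A1, Some A2)
      then Some (Or A1 A2) else None
  | GenTree.Node 3 [:: t1; t2] =>
      if (formula_of_tree t1, formula_of_tree t2) is (Some A1, Some A2)
      then Some (Imp A1 A2) else None
  | GenTree.Node 4 [:: t1] =>
      if formula_of_tree t1 is Some A1 then Some (Box A1) else None
  | _ => None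
  end.

Lemma formula_to_treeK : pcancel formula_to_tree formula_of_tree.
Proof.
by elim=> [n||A IHA B IHB|A IHA B IHB|A IHA B IHB|A IHA] //=;
  rewrite IHA ?IHB.
Qed.

HB.instance Definition _ := Countable.copy formula (pcan_type formula_to_treeK).

Definition sequent : Type := ({mset formula} * {mset formula})%type.

Notation "G ⇒ D" := ((G, D) : sequent) (at level 90, no associativity) : mset_scope.

(* Image with multiplicities. *)
Definition boxes (P : {mset formula}) : {mset formula} :=
  seq_mset [seq Box A | A <- P].

(* A rule is the set of its instances: the premisses, then the conclusion. *)
Definition rule : Type := seq sequent -> sequent -> Prop.

Definition rule_or (R S : rule) : rule := fun ps c => R ps c \/ S ps c.

Notation "R ⊕ S" := (rule_or R S) (at level 50, left associativity) : mset_scope.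

Implicit Types (n : nat) (A B : formula) (G D P S : {mset formula}).

Variant G3cp : rule :=
  | Init n G D : G3cp [::] (Var n +` G ⇒ D `+` [mset Var n])
  | L_bot G D : G3cp [::] (Bot +` G ⇒ D)
  | L_and A B G D :
      G3cp [:: (A +` (B +` G) ⇒ D)]
           (And A B +` G ⇒ D)
  | R_and A B G D :
      G3cp [:: (G ⇒ D `+` [mset A]); (G ⇒ D `+` [mset B])]
           (G ⇒ D `+` [mset And A B])
  | L_or A B G D :
      G3cp [:: (A +` G ⇒ D); (B +` G ⇒ D)]
           (Or A B +` G ⇒ D)
  | R_or A B G D :
      G3cp [:: (G ⇒ D `+` [mset A] `+` [mset B])]
           (G ⇒ D `+` [mset Or A B])
  | L_imp A B G D :
      G3cp [:: (G ⇒ D `+` [mset A]); (B +` G ⇒ D)]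
           (Imp A B +` G ⇒ D)
  | R_imp A B G D :
      G3cp [:: (A +` G ⇒ D `+` [mset B])]
           (G ⇒ D `+` [mset Imp A B]).

Variant LR_E : rule :=
  | LR_E_inst A B G D :
      LR_E [:: ([mset A] ⇒ [mset B]); ([mset B] ⇒ [mset A])]
           (Box A +` G ⇒ D `+` [mset Box B]).

Variant LR_M : rule :=
  | LR_M_inst A B G D :
      LR_M [:: ([mset A] ⇒ [mset B])]
           (Box A +` G ⇒ D `+` [mset Box B]).

Variant LR_R : rule :=
  | LR_R_inst A P B G D :
      LR_R [:: (A +` P ⇒ [mset B])]
           (Box A +` (boxes P `+` G) ⇒ D `+` [mset Box B]).

Variant LR_C : rule :=
  | LR_C_inst P B G D of 1 <= size P :
      LR_C ((P ⇒ [mset B]) :: [seq ([mset B] ⇒ [mset A]) | A <- P])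
           (boxes P `+` G ⇒ D `+` [mset Box B]).

Variant LR_K : rule :=
  | LR_K_inst P B G D :
      LR_K [:: (P ⇒ [mset B])]
           (boxes P `+` G ⇒ D `+` [mset Box B]).

Variant R_N : rule :=
  | R_N_inst B G D :
      R_N [:: (mset0 ⇒ [mset B])]
          (G ⇒ D `+` [mset Box B]).

Variant L_D_bot : rule :=
  | L_D_bot_inst A G D :
      L_D_bot [:: ([mset A] ⇒ mset0)]
              (Box A +` G ⇒ D).

Variant L_D_diaE : rule :=
  | L_D_diaE_inst P G D of size P <= 2 :
      L_D_diaE [:: (P ⇒ mset0); (mset0 ⇒ P)]
               (boxes P `+` G ⇒ D).

Variant L_D_diaM : rule :=
  | L_D_diaM_inst P G D of size P <= 2 :
      L_D_diaM [:: (P ⇒ mset0)]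
               (boxes P `+` G ⇒ D).

(* P or S may be empty, in which case only the first premiss remains. *)
Variant L_D_diaC : rule :=
  | L_D_diaC_inst P S G D :
      L_D_diaC ((P `+` S ⇒ mset0) ::
                  [seq (mset0 ⇒ [mset A; B]) | A <- P, B <- S])
               (boxes P `+` (boxes S `+` G) ⇒ D).

Variant L_D_star : rule :=
  | L_D_star_inst P G D :
      L_D_star [:: (P ⇒ mset0)]
               (boxes P `+` G ⇒ D).

Variant calculus : Type :=
  | G3E | G3EN | G3M | G3MN | G3C | G3CN | G3R | G3K
  | G3ED_bot | G3END_bot | G3ED_dia | G3ED | G3END
  | G3MD_bot | G3MND_bot | G3MD | G3MND
  | G3CD_dia | G3CD | G3CND | G3RD | G3KD.

Definition modal_rules (X : calculus) : rule :=
  match X with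
  | G3E => LR_E
  | G3EN => LR_E ⊕ R_N
  | G3M => LR_M
  | G3MN => LR_M ⊕ R_N
  | G3C => LR_C
  | G3CN => LR_C ⊕ R_N
  | G3R => LR_R
  | G3K => LR_K
  | G3ED_bot => LR_E ⊕ L_D_bot
  | G3END_bot => LR_E ⊕ R_N ⊕ L_D_bot
  | G3ED_dia => LR_E ⊕ L_D_diaE
  | G3ED => LR_E ⊕ L_D_bot ⊕ L_D_diaE
  | G3END => LR_E ⊕ R_N ⊕ L_D_bot ⊕ L_D_diaE
  | G3MD_bot => LR_M ⊕ L_D_bot
  | G3MND_bot => LR_M ⊕ R_N ⊕ L_D_bot
  | G3MD => LR_M ⊕ L_D_diaM
  | G3MND => LR_M ⊕ R_N ⊕ L_D_diaM
  | G3CD_dia => LR_C ⊕ L_D_diaC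
  | G3CD => LR_C ⊕ L_D_star
  | G3CND => LR_C ⊕ R_N ⊕ L_D_star
  | G3RD => LR_R ⊕ L_D_star
  | G3KD => LR_K ⊕ L_D_star
  end.

Definition rules (X : calculus) : rule := G3cp ⊕ modal_rules X.

(* [derivable X c] iff there is a finite derivation tree with root [c]; the
   leaves are the instances of [Init] and [L_bot], which have no premisses. *)
Inductive derivable (X : calculus) : sequent -> Prop :=
  | derivable_rule ps c :
      rules X ps c -> (forall p : sequent, p \in ps -> derivable X p) -> derivable X c.

(* Main.v *)
Require Import Defs.
From mathcomp Require Import all_boot zify.
From mathcomp Require Import finmap multiset.

(* A sequent is read as a multiset of signed formulas, which merges each pair of
   left and right rules into one scheme: every propositional rule is invertible,
   and every modal rule consists of boxed principal formulas, premisses made of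
   their unboxed versions only, and an arbitrary context.  Contraction and cut
   are then proved by induction on the formula, without derivation heights.  On
   compound propositional formulas inversion reduces them to the immediate
   subformulas.  On boxed formulas an induction on the derivation permutes them
   upwards until the box is principal, where they reduce to contraction or cut
   on the unboxed formula in the premisses of the modal rules. *)

Set Implicit Arguments.
Unset Strict Implicit.
Unset Printing Implicit Defensive.

Local Open Scope mset_scope.

Definition signed : Type := (bool * formula)%type.

Implicit Types (A B : formula) (P Q : seq formula) (s : signed) (C E : seq signed).

Definition signed_sequent P Q : seq signed :=
  [seq (true, A) | A <- P] ++ [seq (false, A) | A <- Q].

Definition boxed_sequent P Q : seq signed :=
  signed_sequent (map Box P) (map Box Q).

(* [None]: no propositional rule has this principal formula; [Some [::]]: the
   zero-premiss rule of falsum. *)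
Definition premisses s : option (seq (seq signed)) :=
  match s with
  | (true, Bot) => Some [::]
  | (true, And A B) => Some [:: [:: (true, A); (true, B)]]
  | (false, And A B) => Some [:: [:: (false, A)]; [:: (false, B)]]
  | (true, Or A B) => Some [:: [:: (true, A)]; [:: (true, B)]]
  | (false, Or A B) => Some [:: [:: (false, A); (false, B)]]
  | (true, Imp A B) => Some [:: [:: (false, A)]; [:: (true, B)]]
  | (false, Imp A B) => Some [:: [:: (true, A); (false, B)]]
  | _ => None
  end.

(* A modal rule, stripped of its context, as a relation between the unboxed
   principal formulas [P ⇒ Q]: its premisses satisfy the predicate [d]. *)
Definition modal_step : Type :=
  (seq signed -> Prop) -> seq formula -> seq formula -> Prop.

Definition step_or (st1 st2 : modal_step) : modal_step :=
  fun d P Q => st1 d P Q \/ st2 d P Q.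

(* LR-M, LR-R, LR-K and R-N differ only in the number of boxes allowed on the
   left; likewise LR-E and LR-C, and L-D^bot, L-D^dia_M and L-D^*. *)
Variant step_K (c : pred nat) (d : seq signed -> Prop) :
    seq formula -> seq formula -> Prop :=
  | Step_K P B of c (size P) & d (signed_sequent P [:: B]) :
      step_K c d P [:: B].

Variant step_C (c : pred nat) (d : seq signed -> Prop) :
    seq formula -> seq formula -> Prop :=
  | Step_C P B of c (size P) & d (signed_sequent P [:: B])
      & (forall A, A \in P -> d (signed_sequent [:: B] [:: A])) :
      step_C c d P [:: B].

Variant step_D (c : pred nat) (d : seq signed -> Prop) :
    seq formula -> seq formula -> Prop :=
  | Step_D P of c (size P) & d (signed_sequent P [::]) : step_D c d P [::].

Variant step_diaE (d : seq signed -> Prop) : seq formula -> seq formula -> Prop :=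
  | Step_diaE P of size P <= 2 & d (signed_sequent P [::])
      & d (signed_sequent [::] P) : step_diaE d P [::].

Variant step_diaC (d : seq signed -> Prop) : seq formula -> seq formula -> Prop :=
  | Step_diaC P P1 P2 of perm_eq P (P1 ++ P2) & d (signed_sequent P [::])
      & (forall A B, A \in P1 -> B \in P2 -> d (signed_sequent [::] [:: A; B])) :
      step_diaC d P [::].

Local Notation "R ⊞ S" := (step_or R S) (at level 50, left associativity).
Local Notation step_N := (step_K (pred1 0)).

Definition step (X : calculus) : modal_step :=
  match X with
  | G3E => step_C (pred1 1)
  | G3EN => step_C (pred1 1) ⊞ step_N
  | G3M => step_K (pred1 1)
  | G3MN => step_K (pred1 1) ⊞ step_N
  | G3C => step_C (leq 1)
  | G3CN => step_C (leq 1) ⊞ step_N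
  | G3R => step_K (leq 1)
  | G3K => step_K predT
  | G3ED_bot => step_C (pred1 1) ⊞ step_D (pred1 1)
  | G3END_bot => step_C (pred1 1) ⊞ step_N ⊞ step_D (pred1 1)
  | G3ED_dia => step_C (pred1 1) ⊞ step_diaE
  | G3ED => step_C (pred1 1) ⊞ step_D (pred1 1) ⊞ step_diaE
  | G3END => step_C (pred1 1) ⊞ step_N ⊞ step_D (pred1 1) ⊞ step_diaE
  | G3MD_bot => step_K (pred1 1) ⊞ step_D (pred1 1)
  | G3MND_bot => step_K (pred1 1) ⊞ step_N ⊞ step_D (pred1 1)
  | G3MD => step_K (pred1 1) ⊞ step_D (geq 2)
  | G3MND => step_K (pred1 1) ⊞ step_N ⊞ step_D (geq 2)
  | G3CD_dia => step_C (leq 1) ⊞ step_diaC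
  | G3CD => step_C (leq 1) ⊞ step_D predT
  | G3CND => step_C (leq 1) ⊞ step_N ⊞ step_D predT
  | G3RD => step_K (leq 1) ⊞ step_D predT
  | G3KD => step_K predT ⊞ step_D predT
  end.

(* Quantifying over a subset [d] of the derivable sequents keeps the occurrence
   of [signed_derivable] in the modal clause strictly positive. *)
Inductive signed_derivable (X : calculus) : seq signed -> Prop :=
  | der_ax n E of (true, Var n) \in E & (false, Var n) \in E :
      signed_derivable X E
  | der_prop s L C E of premisses s = Some L & perm_eq E (s :: C)
      & (forall a, a \in L -> signed_derivable X (a ++ C)) :
      signed_derivable X E
  | der_modal d P Q C E of (forall x, d x -> signed_derivable X x)
      & step X d P Q & perm_eq E (boxed_sequent P Q ++ C) :
      signed_derivable X E.

Ltac perm_count :=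
  let f := fresh "f" in apply/permP=> f;
  repeat match goal with
    H : is_true (perm_eq _ _) |- _ => move/permP/(_ f): H end;
  rewrite /boxed_sequent /signed_sequent;
  do 4 rewrite ?map_cat ?count_cat /=; lia.

Ltac size_arith := rewrite /=; lia.

Ltac subset_cases :=
  let x := fresh "x" in
  move=> x; rewrite /signed_sequent ?map_cat /= ?(mem_cat, inE) /=;
  repeat match goal with
  | |- context [x \in ?t] => case: (x \in t)
  | |- context [x == ?t] => case: (x == t) end; done.

Section Steps.

Variables (X : calculus) (d : seq signed -> Prop).

Lemma step_sub (d' : seq signed -> Prop) P Q :
  (forall x, d x -> d' x) -> step X d P Q -> step X d' P Q.
Proof.
move=> dd'.
have hK c : step_K c d P Q -> step_K c d' P Q.
  by case=> ? ? ? /dd'; constructor.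
have hC c : step_C c d P Q -> step_C c d' P Q.
  by case=> ? ? ? /dd' ? h; constructor=> // A /h /dd'.
have hD c : step_D c d P Q -> step_D c d' P Q.
  by case=> ? ? /dd'; constructor.
have hE : step_diaE d P Q -> step_diaE d' P Q.
  by case=> ? ? /dd' ? /dd'; constructor.
have hdC : step_diaC d P Q -> step_diaC d' P Q.
  case=> ? P1 P2 eP /dd' dP h; apply: (Step_diaC eP dP).
  by move=> A B /h /[apply] /dd'.
by case: X => /=; rewrite /step_or; intuition.
Qed.

Lemma size_step_right P Q : step X d P Q -> size Q <= 1.
Proof.
have hK c : step_K c d P Q -> size Q <= 1 by case.
have hC c : step_C c d P Q -> size Q <= 1 by case.
have hD c : step_D c d P Q -> size Q <= 1 by case.
have hE : step_diaE d P Q -> size Q <= 1 by case.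
have hdC : step_diaC d P Q -> size Q <= 1 by case.
by case: X => /=; rewrite /step_or; intuition eauto.
Qed.

Hypothesis d_perm : forall C E, perm_eq C E -> d C -> d E.

Lemma step_perm P P' Q : perm_eq P P' -> step X d P Q -> step X d P' Q.
Proof.
move=> eP.
have hs R : d (signed_sequent P R) -> d (signed_sequent P' R).
  by apply: d_perm; rewrite perm_cat2r perm_map.
have hr : d (signed_sequent [::] P) -> d (signed_sequent [::] P').
  by apply: d_perm; rewrite perm_map.
have hK c : step_K c d P Q -> step_K c d P' Q.
  by inversion_clear 1; constructor; [rewrite -(perm_size eP) | apply: hs].
have hC c : step_C c d P Q -> step_C c d P' Q.
  inversion_clear 1; constructor; rewrite -?(perm_size eP) //; first exact: hs.
  by move=> A; rewrite -(perm_mem eP); auto.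
have hD c : step_D c d P Q -> step_D c d P' Q.
  by inversion_clear 1; constructor; [rewrite -(perm_size eP) | apply: hs].
have hE : step_diaE d P Q -> step_diaE d P' Q.
  by inversion_clear 1; constructor; rewrite -?(perm_size eP) //; auto.
have hdC : step_diaC d P Q -> step_diaC d P' Q.
  inversion_clear 1 as [? P1 P2 e ? ?]; apply: (@Step_diaC _ _ P1 P2); auto.
  by rewrite -(permPl eP).
by case: X => /=; rewrite /step_or; intuition.
Qed.

Lemma step_contract A P Q :
  (forall b C, d [:: (b, A), (b, A) & C] -> d ((b, A) :: C)) ->
  step X d [:: A, A & P] Q -> step X d (A :: P) Q.
Proof.
move=> d_contr.
have hs R : d (signed_sequent [:: A, A & P] R) -> d (signed_sequent (A :: P) R).
  exact: d_contr.
have hK (c : pred nat) : (forall n, c n.+2 -> c n.+1) ->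
    step_K c d [:: A, A & P] Q -> step_K c d (A :: P) Q.
  by move=> hc; inversion_clear 1; constructor; [apply: hc | apply: hs].
have hC (c : pred nat) : (forall n, c n.+2 -> c n.+1) ->
    step_C c d [:: A, A & P] Q -> step_C c d (A :: P) Q.
  move=> hc; inversion_clear 1 as [? ? ? ? h].
  constructor; [exact: hc | exact: hs | ].
  by move=> A1 A1P; apply: h; rewrite inE A1P orbT.
have hD (c : pred nat) : (forall n, c n.+2 -> c n.+1) ->
    step_D c d [:: A, A & P] Q -> step_D c d (A :: P) Q.
  by move=> hc; inversion_clear 1; constructor; [apply: hc | apply: hs].
have hE : step_diaE d [:: A, A & P] Q -> step_diaE d (A :: P) Q.
  inversion_clear 1.
  by constructor; [apply: ltnW | apply: hs | apply: d_contr].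
have hdC : step_diaC d [:: A, A & P] Q -> step_diaC d (A :: P) Q.
  inversion_clear 1 as [? P1 P2 e dP h].
  have [AP2|AP2] := boolP (A \in P2).
    apply: (@Step_diaC _ _ P1 (rem A P2)); auto.
      by move: e (perm_to_rem AP2) => *; perm_count.
    by move=> A1 A2 A1P /mem_rem; apply: h.
  have AP1 : A \in P1.
    have : A \in P1 ++ P2 by rewrite -(perm_mem e) mem_head.
    by rewrite mem_cat (negPf AP2) orbF.
  apply: (@Step_diaC _ _ (rem A P1) P2); auto.
    by move: e (perm_to_rem AP1) => *; perm_count.
  by move=> A1 A2 /mem_rem A1P; apply: h.
have hK0 := hK (pred1 0) (fun _ => id); have hK1 := hK (leq 1) (fun _ => id).
have hKT := hK predT (fun _ => id); have hC1 := hC (leq 1) (fun _ => id).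
have hDT := hD predT (fun _ => id).
have hKp : step_K (pred1 1) d [:: A, A & P] Q -> step_K (pred1 1) d (A :: P) Q.
  by apply: hK.
have hCp : step_C (pred1 1) d [:: A, A & P] Q -> step_C (pred1 1) d (A :: P) Q.
  by apply: hC.
have hDp : step_D (pred1 1) d [:: A, A & P] Q -> step_D (pred1 1) d (A :: P) Q.
  by apply: hD.
have hD2 : step_D (geq 2) d [:: A, A & P] Q -> step_D (geq 2) d (A :: P) Q.
  by apply: hD => n /ltnW.
by case: X => /=; rewrite /step_or; intuition.
Qed.

Lemma step_cut A P P' Q :
  (forall C E, {subset C <= E} -> d C -> d E) ->
  (forall C, d ((true, A) :: C) -> d ((false, A) :: C) -> d C) ->
  step X d P [:: A] -> step X d (A :: P') Q ->
  step X d (P ++ P') Q \/ d [::].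
Proof.
move=> d_sub d_cut.
have mcut P1 P2 Q1 Q2 :
    d (signed_sequent P1 (A :: Q1)) -> d (signed_sequent (A :: P2) Q2) ->
    d (signed_sequent (P1 ++ P2) (Q1 ++ Q2)).
  by move=> d1 d2; apply: d_cut; [apply: d_sub d2 | apply: d_sub d1]; subset_cases.
have nD c : ~ step_D c d P [:: A] by inversion 1.
have nE : ~ step_diaE d P [:: A] by inversion 1.
have ndC : ~ step_diaC d P [:: A] by inversion 1.
have nN : ~ step_N d (A :: P') Q by inversion 1.
have CK c : step_C c d P [:: A] -> step_K c d P [:: A].
  by inversion_clear 1; constructor.
have KK (c1 c2 c3 : pred nat) : (forall m n, c1 m -> c2 n.+1 -> c3 (m + n)) ->
    step_K c1 d P [:: A] -> step_K c2 d (A :: P') Q -> step_K c3 d (P ++ P') Q.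
  move=> hc; inversion_clear 1; inversion_clear 1; constructor.
    by rewrite size_cat; apply: hc.
  exact: (mcut _ _ [::]).
have KD (c1 c2 c3 : pred nat) : (forall m n, c1 m -> c2 n.+1 -> c3 (m + n)) ->
    step_K c1 d P [:: A] -> step_D c2 d (A :: P') Q -> step_D c3 d (P ++ P') Q.
  move=> hc; inversion_clear 1; inversion_clear 1; constructor.
    by rewrite size_cat; apply: hc.
  exact: (mcut _ _ [::]).
have CC (c : pred nat) : (forall m n, c m -> c n.+1 -> c (m + n)) ->
    step_C c d P [:: A] -> step_C c d (A :: P') Q -> step_C c d (P ++ P') Q.
  move=> hc; inversion_clear 1 as [? ? ? dP dA].
  inversion_clear 1 as [? B ? dP' dB]; constructor.
  - by rewrite size_cat; apply: hc.
  - exact: (mcut _ _ [::]).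
  move=> A'; rewrite mem_cat => /orP[/dA dA'|A'P']; last first.
    by apply: dB; rewrite inE A'P' orbT.
  by apply: (mcut [:: B] [::] [::]) dA'; apply: dB; apply: mem_head.
have NC (c : pred nat) : (forall n, c n.+2 -> c n.+1) -> step_N d P [:: A] ->
    step_C c d (A :: P') Q -> step_C c d (P ++ P') Q \/ step_N d (P ++ P') Q.
  move=> hc; inversion_clear 1 as [? ? sP dP]; move/eqP/size0nil: sP => P0.
  inversion_clear 1 as [? B cP' dP' dB]; rewrite P0 in dP *.
  have dPB : d (signed_sequent P' [:: B]) by apply: (mcut [::] _ [::]).
  case: P' cP' dB dPB {dP' nN KK KD CC} => [|A' P'] cP' dB dPB; first by right.
  left; constructor=> //; first exact: hc.
  by move=> A1 A1P; apply: dB; rewrite inE A1P orbT.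
have CE : step_C (pred1 1) d P [:: A] ->
    step_diaE d (A :: P') Q -> step_diaE d (P ++ P') Q.
  inversion_clear 1 as [? ? sP dP dA]; move/eqP: sP => sP.
  inversion_clear 1 as [? sP' dP' dP'']; constructor.
  - by rewrite size_cat sP.
  - exact: (mcut _ _ [::]).
  have [B defP] : exists B, P = [:: B].
    by case: P sP {dP dA mcut nD nE ndC CK KK KD CC NC} => [|B []] // _; exists B.
  have := mcut [::] [::] P' [:: B] dP'' (dA B _); rewrite defP mem_head.
  by move=> /(_ isT); apply: d_sub; subset_cases.
have NE : step_N d P [:: A] -> step_diaE d (A :: P') Q ->
    step_D (pred1 1) d (P ++ P') Q \/ d [::].
  inversion_clear 1 as [? ? sP dP]; move/eqP/size0nil: sP => P0.
  inversion_clear 1 as [? sP' dP' dE]; rewrite P0 in dP *.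
  have dPB : d (signed_sequent P' [::]) by apply: (mcut [::] _ [::]).
  case: P' sP' dPB {nN KK KD CC NC CE dP' dE} => [|B []] //= _ dPB; first by right.
  by left.
have CdC : step_C (leq 1) d P [:: A] ->
    step_diaC d (A :: P') Q -> step_diaC d (P ++ P') Q.
  inversion_clear 1 as [? ? ? dP dA]; inversion_clear 1 as [? P1 P2 e dP' dP12].
  have dPP' : d (signed_sequent (P ++ P') [::]) by apply: (mcut _ _ [::]).
  have [AP1|AP1] := boolP (A \in P1).
    apply: (@Step_diaC _ _ (P ++ rem A P1) P2) => //.
      by move: e (perm_to_rem AP1) => *; perm_count.
    move=> A1 B; rewrite mem_cat => /orP[/dA dA1|/mem_rem A1P] BP; last exact: dP12.
    have := mcut [::] [::] [:: B] [:: A1] (dP12 _ _ AP1 BP) dA1.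
    by apply: d_sub; subset_cases.
  have AP2 : A \in P2.
    have : A \in P1 ++ P2 by rewrite -(perm_mem e) mem_head.
    by rewrite mem_cat (negPf AP1).
  apply: (@Step_diaC _ _ P1 (P ++ rem A P2)) => //.
    by move: e (perm_to_rem AP2) => *; perm_count.
  move=> B A1 BP; rewrite mem_cat => /orP[/dA dA1|/mem_rem A1P]; last exact: dP12.
  apply: (mcut [::] [::] [:: B] [:: A1]) dA1.
  by apply: d_sub (dP12 _ _ BP AP2); subset_cases.
have D0 : step_D (pred1 0) d (P ++ P') Q -> d [::].
  by inversion_clear 1 as [? sP dP]; move/eqP/size0nil: sP dP => ->.
have CK1 := CK (pred1 1); have CKs := CK (leq 1).
have CC1 := CC (pred1 1) ltac:(size_arith).
have CCs := CC (leq 1) ltac:(size_arith).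
have NC1 := NC (pred1 1) ltac:(size_arith).
have NCs := NC (leq 1) ltac:(size_arith).
have KK1 := KK (pred1 1) (pred1 1) (pred1 1) ltac:(size_arith).
have NK1 := KK (pred1 0) (pred1 1) (pred1 0) ltac:(size_arith).
have KKs := KK (leq 1) (leq 1) (leq 1) ltac:(size_arith).
have KKT := KK predT predT predT ltac:(size_arith).
have KD1 := KD (pred1 1) (pred1 1) (pred1 1) ltac:(size_arith).
have ND1 := KD (pred1 0) (pred1 1) (pred1 0) ltac:(size_arith).
have KD2 := KD (pred1 1) (geq 2) (geq 2) ltac:(size_arith).
have ND2 := KD (pred1 0) (geq 2) (geq 2) ltac:(size_arith).
have KDs := KD (leq 1) predT predT ltac:(size_arith).
have NDT := KD (pred1 0) predT predT ltac:(size_arith).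
have KDT := KD predT predT predT ltac:(size_arith).
case: X => /=; rewrite /step_or; intuition try solve [exfalso; eauto].
Qed.

End Steps.

Section SignedCalculus.

Variable X : calculus.
Local Notation der := (signed_derivable X).

Lemma der_perm C E : perm_eq C E -> der C -> der E.
Proof.
move=> eE hC; case: hC eE => {C} [n C hT hF | s L C' C hs eC h | d P Q C' C hd st eC] eE.
- by apply: (@der_ax _ n); rewrite -(perm_mem eE).
- by apply: (der_prop hs _ h); rewrite -(permPl eE).
- by apply: (der_modal (C := C') hd st); rewrite -(permPl eE).
Qed.

Lemma der_step P Q C : step X der P Q -> der (boxed_sequent P Q ++ C).
Proof. by move=> st; apply: (der_modal (fun _ => id) st). Qed.

(* The propositional rules permute below the replacement of [R] by [W], so only
   axioms and modal rules have to be examined. *)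
Lemma der_replace R W :
  (forall s, s \in R -> premisses s = None) ->
  (forall n C, (true, Var n) \in R ++ C -> (false, Var n) \in R ++ C ->
     der (W ++ C)) ->
  (forall P Q C C', step X der P Q ->
     perm_eq (R ++ C) (boxed_sequent P Q ++ C') -> der (W ++ C)) ->
  forall C, der (R ++ C) -> der (W ++ C).
Proof.
move=> hR hax hmod.
suff gen E : der E -> forall C, perm_eq E (R ++ C) -> der (W ++ C).
  by move=> C /gen; apply.
elim=> {E} [n E hT hF | s L C' E hs eE _ IH | d P Q C' E hd _ st eE] C eC.
- by apply: (hax n); rewrite -(perm_mem eC).
- have sR : s \notin R by apply/negP => /hR; rewrite hs.
  have sC : s \in C.
    have : s \in R ++ C by rewrite -(perm_mem eC) (perm_mem eE) mem_head.
    by rewrite mem_cat (negPf sR).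
  have rC := perm_to_rem sC.
  apply: (der_prop (C := W ++ rem s C) hs); first by perm_count.
  move=> a aL; apply: (@der_perm (W ++ (a ++ rem s C))); first by perm_count.
  by apply: (IH _ aL); perm_count.
- by apply: (hmod P Q _ C'); [apply: step_sub st | rewrite -(permPl eC)].
Qed.

Lemma der_weaken W C : der C -> der (W ++ C).
Proof.
apply: (@der_replace [::]) => // [n {}C hT hF | P Q {}C C' st eC].
  by apply: (@der_ax _ n); rewrite mem_cat ?hT ?hF orbT.
by apply: (@der_perm (boxed_sequent P Q ++ (W ++ C'))); [perm_count | apply: der_step].
Qed.

Lemma mem_boxed_sequent s P Q :
  s \in boxed_sequent P Q ->
  exists A, s.2 = Box A /\ A \in (if s.1 then P else Q).
Proof.
rewrite mem_cat => /orP[] /mapP[_ /mapP[A AP ->] ->]; by exists A.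
Qed.

Lemma der_invert s L a C :
  premisses s = Some L -> a \in L -> der (s :: C) -> der (a ++ C).
Proof.
move=> hs aL.
suff gen E : der E -> forall C, perm_eq E (s :: C) -> der (a ++ C).
  by move=> /gen; apply.
elim=> {C E} [n E hT hF | s' L' C' E hs' eE h IH | d P Q C' E hd _ st eE] C eC.
- have mem b : (b, Var n) \in E -> (b, Var n) \in a ++ C.
    rewrite (perm_mem eC) inE mem_cat => /orP[/eqP e|->]; last by rewrite orbT.
    by move: hs; rewrite -e; case: (b).
  by apply: (@der_ax _ n); apply: mem.
- have [ss'|ss'] := eqVneq s s'.
    have aL' : a \in L' by move: hs; rewrite ss' hs' => -[->].
    by apply: der_perm (h _ aL'); rewrite -ss' in eE; perm_count.
  have sC' : s \in C'.
    have : s \in s' :: C' by rewrite -(perm_mem eE) (perm_mem eC) mem_head.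
    by rewrite inE (negPf ss').
  have rC' := perm_to_rem sC'.
  apply: (der_prop (C := a ++ rem s C') hs'); first by perm_count.
  move=> a' aL'; apply: (@der_perm (a ++ (a' ++ rem s C'))); first by perm_count.
  by apply: (IH _ aL'); perm_count.
- have sC' : s \in C'.
    have : s \in boxed_sequent P Q ++ C'.
      by rewrite -(perm_mem eE) (perm_mem eC) mem_head.
    rewrite mem_cat => /orP[/mem_boxed_sequent[A [e _]]|//].
    by move: s e hs {eC} => [[] _] /= ->.
  have rC' := perm_to_rem sC'.
  by apply: (der_modal (C := a ++ rem s C') hd st); perm_count.
Qed.

Lemma perm_boxed_sequent P P' Q :
  perm_eq P P' -> perm_eq (boxed_sequent P Q) (boxed_sequent P' Q).
Proof. by move=> eP; rewrite perm_cat2r !perm_map. Qed.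

Definition immediate_subformula A B : Prop :=
  match A with
  | And A1 A2 | Or A1 A2 | Imp A1 A2 => B = A1 \/ B = A2
  | _ => False
  end.

Lemma premisses_subformula s L a x : premisses s = Some L -> a \in L -> x \in a ->
  immediate_subformula s.2 x.2.
Proof.
case: s => [[] []] //= => [|A B|A B|A B|A B|A B|A B] [<-] //; rewrite !inE.
all: try by move=> /eqP->; rewrite !inE => /orP[] /eqP->; auto.
all: by move=> /orP[] /eqP->; rewrite !inE => /eqP->; auto.
Qed.

Lemma der_contract_seq a C :
  (forall s E, s \in a -> der [:: s, s & E] -> der (s :: E)) ->
  der (a ++ a ++ C) -> der (a ++ C).
Proof.
elim: a C => [|s a IH] C //= contr h.
apply: (@der_perm (a ++ (s :: C))); first by perm_count.
apply: IH; first by move=> s' E s'a; apply: contr; rewrite inE s'a orbT.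
apply: (@der_perm (s :: (a ++ a ++ C))); first by perm_count.
by apply: contr; [apply: mem_head | apply: der_perm h; perm_count].
Qed.

Lemma der_contract A b C : der [:: (b, A), (b, A) & C] -> der ((b, A) :: C).
Proof.
move: A b C.
have prop A b L C : premisses (b, A) = Some L ->
    (forall B b' E, immediate_subformula A B ->
       der [:: (b', B), (b', B) & E] -> der ((b', B) :: E)) ->
    der [:: (b, A), (b, A) & C] -> der ((b, A) :: C).
  move=> hL contr h; apply: (der_prop hL (perm_refl _)) => a aL.
  apply: der_contract_seq => [[b' B] E xa|].
    exact/contr/(premisses_subformula hL aL xa).
  apply: (der_invert hL aL); apply: (@der_perm (a ++ ((b, A) :: C))).
    by perm_count.
  exact: (der_invert hL aL h).
have atomic s : premisses s = None ->
    (forall A, s = (true, Box A) ->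
       forall b E, der [:: (b, A), (b, A) & E] -> der ((b, A) :: E)) ->
    forall C, der [:: s, s & C] -> der (s :: C).
  move=> hs hbox; apply: (@der_replace [:: s; s] [:: s]) => [x|n C|P Q C C' st eC].
  - by rewrite !inE orbb => /eqP->.
  - by rewrite !inE !orbA !orbb => hT hF; apply: (@der_ax _ n); rewrite inE.
  have [sC'|sC'] := boolP (s \in C').
    have rC' := perm_to_rem sC'.
    apply: (@der_perm (boxed_sequent P Q ++ rem s C')); last exact: der_step.
    by rewrite perm_sym; perm_count.
  have sPQ : s \in boxed_sequent P Q.
    have : s \in boxed_sequent P Q ++ C' by rewrite -(perm_mem eC) mem_head.
    by rewrite mem_cat (negPf sC') orbF.
  have [A [eA AP]] := mem_boxed_sequent sPQ.
  case: s eA AP {hs sPQ} hbox eC sC' => [[] _] /= -> AP hbox eC sC'; last first.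
    have sQ := size_step_right st.
    have eQ : Q = [:: A].
      by case: Q sQ AP {st eC} => [|B []] //; rewrite inE => _ /eqP->.
    have e : perm_eq ((false, Box A) :: C) (boxed_sequent P [::] ++ C').
      by rewrite eQ in eC; perm_count.
    have : (false, Box A) \in boxed_sequent P [::] ++ C'.
      by rewrite -(perm_mem e) mem_head.
    rewrite mem_cat (negPf sC') orbF => /mem_boxed_sequent[? []].
    by rewrite in_nil.
  have rP := perm_to_rem AP; have bP := perm_boxed_sequent Q rP.
  have AP' : A \in rem A P.
    have e : perm_eq ((true, Box A) :: C) (boxed_sequent (rem A P) Q ++ C').
      by perm_count.
    have : (true, Box A) \in boxed_sequent (rem A P) Q ++ C'.
      by rewrite -(perm_mem e) mem_head.
    by rewrite mem_cat (negPf sC') orbF => /mem_boxed_sequent[_ [[<-]]].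
  have rP' := perm_to_rem AP'.
  have eP : perm_eq P [:: A, A & rem A (rem A P)] by perm_count.
  have := perm_boxed_sequent Q eP => eb.
  have st' : step X der (A :: rem A (rem A P)) Q.
    apply: step_contract; first exact: (hbox A).
    by apply: step_perm st; [exact: der_perm | ].
  by apply: der_perm (der_step C' st'); perm_count.
elim=> [n||A IHA B IHB|A IHA B IHB|A IHA B IHB|A IHA] [] C.
all: try by apply: atomic => // A' [<-].
all: apply: prop; first by [].
all: move=> F b E [].
all: by move=> ->; first [exact: IHA | exact: IHB].
Qed.

Lemma der_sub C E : {subset C <= E} -> der C -> der E.
Proof.
move=> sub hC.
have {hC}: der (C ++ E) by apply: der_perm (der_weaken E hC); rewrite perm_catC.
elim: C sub => [|s C IH] //= sub hC.
apply: IH => [x xC|]; first by apply: sub; rewrite inE xC orbT.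
have rE := perm_to_rem (sub s (mem_head _ _)).
case: s rE hC {sub} => b A rE hC.
apply: (@der_perm ((b, A) :: C ++ rem (b, A) E)); first by perm_count.
by apply: der_contract; apply: der_perm hC; perm_count.
Qed.

Lemma der_step_side s W P Q C C' : s \in C' -> step X der P Q ->
  perm_eq (s :: C) (boxed_sequent P Q ++ C') -> der (W ++ C).
Proof.
move=> sC' st e; have rC' := perm_to_rem sC'.
by apply: der_perm (der_step (W ++ rem s C') st); perm_count.
Qed.

Lemma der_cut_box A C C' :
  (forall E, der ((true, A) :: E) -> der ((false, A) :: E) -> der E) ->
  der ((true, Box A) :: C) -> der ((false, Box A) :: C') -> der (C ++ C').
Proof.
move=> cutA dT; apply: (@der_replace [:: (false, Box A)]) => {C'}.
- by move=> s; rewrite inE => /eqP->.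
- move=> n C'; rewrite !inE => /predU1P[//|hT] /predU1P[//|hF].
  by apply: (@der_ax _ n); rewrite mem_cat ?hT ?hF orbT.
move=> P Q C1 C' stP eC1.
have [sC'|sC'] := boolP ((false, Box A) \in C'); first exact: der_step_side stP eC1.
have eQ : Q = [:: A].
  have : (false, Box A) \in boxed_sequent P Q ++ C' by rewrite -(perm_mem eC1) mem_head.
  rewrite mem_cat (negPf sC') orbF => /mem_boxed_sequent[_ [[<-]]].
  have sQ := size_step_right stP.
  by case: Q sQ {stP eC1} => [|B []] //= _; rewrite inE => /eqP->.
rewrite {}eQ in stP eC1.
apply: (@der_sub (boxed_sequent P [::] ++ C)).
  have e : perm_eq C1 (boxed_sequent P [::] ++ C') by perm_count.
  move=> x; rewrite mem_cat [x \in C ++ C1]mem_cat (perm_mem e).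
  by rewrite [x \in _ ++ C']mem_cat => /orP[]->; rewrite ?orbT.
move: C dT; apply: (@der_replace [:: (true, Box A)]) => {C1 C' eC1 sC'}.
- by move=> s; rewrite inE => /eqP->.
- move=> n C'; rewrite !inE => /predU1P[//|hT] /predU1P[//|hF].
  by apply: (@der_ax _ n); rewrite mem_cat ?hT ?hF orbT.
move=> P' Q' C C' stP' eC.
have [sC'|sC'] := boolP ((true, Box A) \in C'); first exact: der_step_side stP' eC.
have AP' : A \in P'.
  have : (true, Box A) \in boxed_sequent P' Q' ++ C' by rewrite -(perm_mem eC) mem_head.
  by rewrite mem_cat (negPf sC') orbF => /mem_boxed_sequent[_ [[<-]]].
have rP' := perm_to_rem AP'; have bP' := perm_boxed_sequent Q' rP'.
have := step_cut der_sub cutA stP (step_perm der_perm rP' stP').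
case=> [st|d0]; last exact: der_sub d0.
by apply: der_perm (der_step C' st); perm_count.
Qed.

Lemma der_cut A C : der ((true, A) :: C) -> der ((false, A) :: C) -> der C.
Proof.
elim: A C => [n||A IHA B IHB|A IHA B IHB|A IHA B IHB|A IHA] C dT dF.
- apply: (@der_sub (C ++ C)); first by subset_cases.
  apply: (@der_replace [:: (false, Var n)] C _ _ _ C dF).
  + by move=> s; rewrite inE => /eqP->.
  + move=> m C1; rewrite !inE => /predU1P[//|hT] /predU1P[[mn]|hF].
      apply: der_sub dT => x; rewrite inE mem_cat -mn.
      by move=> /predU1P[->|->]; rewrite ?hT ?orbT.
    by apply: (@der_ax _ m); rewrite mem_cat ?hT ?hF orbT.
  move=> P Q C1 C' st eC.
  have: (false, Var n) \in boxed_sequent P Q ++ C' by rewrite -(perm_mem eC) mem_head.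
  rewrite mem_cat => /orP[/mem_boxed_sequent[? []//]|sC'].
  exact: der_step_side st eC.
- move: C dF {dT}; apply: (@der_replace [:: (false, Bot)] [::]).
  + by move=> s; rewrite inE => /eqP->.
  + by move=> m C1; rewrite !inE; apply: der_ax.
  move=> P Q C1 C' st eC.
  have: (false, Bot) \in boxed_sequent P Q ++ C' by rewrite -(perm_mem eC) mem_head.
  rewrite mem_cat => /orP[/mem_boxed_sequent[? []//]|sC'].
  exact: (der_step_side [::] sC' st eC).
- have dT' : der [:: (true, A), (true, B) & C].
    by apply: (@der_invert (true, And A B) _ [:: (true, A); (true, B)] _ erefl _ dT);
      rewrite ?inE ?eqxx ?orbT.
  have dA : der [:: (false, A) & C].
    by apply: (@der_invert (false, And A B) _ [:: (false, A)] _ erefl _ dF);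
      rewrite ?inE ?eqxx ?orbT.
  have dB : der [:: (false, B) & C].
    by apply: (@der_invert (false, And A B) _ [:: (false, B)] _ erefl _ dF);
      rewrite ?inE ?eqxx ?orbT.
  by apply: (IHB _ _ dB); apply: IHA dT' _; apply: der_sub dA; subset_cases.
- have dF' : der [:: (false, A), (false, B) & C].
    by apply: (@der_invert (false, Or A B) _ [:: (false, A); (false, B)] _ erefl _ dF);
      rewrite ?inE ?eqxx ?orbT.
  have dA : der [:: (true, A) & C].
    by apply: (@der_invert (true, Or A B) _ [:: (true, A)] _ erefl _ dT);
      rewrite ?inE ?eqxx ?orbT.
  have dB : der [:: (true, B) & C].
    by apply: (@der_invert (true, Or A B) _ [:: (true, B)] _ erefl _ dT);
      rewrite ?inE ?eqxx ?orbT.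
  by apply: (IHB _ dB); apply: IHA dF'; apply: der_sub dA; subset_cases.
- have dF' : der [:: (true, A), (false, B) & C].
    by apply: (@der_invert (false, Imp A B) _ [:: (true, A); (false, B)] _ erefl _ dF);
      rewrite ?inE ?eqxx ?orbT.
  have dA : der [:: (false, A) & C].
    by apply: (@der_invert (true, Imp A B) _ [:: (false, A)] _ erefl _ dT);
      rewrite ?inE ?eqxx ?orbT.
  have dB : der [:: (true, B) & C].
    by apply: (@der_invert (true, Imp A B) _ [:: (true, B)] _ erefl _ dT);
      rewrite ?inE ?eqxx ?orbT.
  by apply: (IHB _ dB); apply: IHA dF' _; apply: der_sub dA; subset_cases.
- apply: (@der_sub (C ++ C)); first by subset_cases.
  exact: der_cut_box IHA dT dF.
Qed.

End SignedCalculus.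

Definition encode (c : sequent) : seq signed := signed_sequent c.1 c.2.

Definition decode E : sequent :=
  (seq_mset [seq x.2 | x <- E & x.1] ⇒ seq_mset [seq x.2 | x <- E & ~~ x.1]).

Lemma count_msetD (g : pred formula) (M N : {mset formula}) :
  count g (M `+` N) = count g M + count g N.
Proof.
rewrite -count_cat; apply/permP/allP => A _ /=.
by rewrite count_cat !count_mem_mset msetE2.
Qed.

Lemma count_mset1 (g : pred formula) A : count g [mset A] = g A.
Proof. by rewrite enum_msetn /= addn0. Qed.

Lemma count_boxes (g : pred formula) (M : {mset formula}) :
  count g (boxes M) = count (preim Box g) M.
Proof. by rewrite (permP (perm_eq_seq_mset _)) count_map. Qed.

Ltac mset_count :=
  let f := fresh "f" in apply/permP=> f;
  rewrite /encode /boxed_sequent /signed_sequent /=;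
  do 3 rewrite ?count_cat ?count_map ?count_msetD ?count_mset1 ?count_boxes
    ?enum_mset0 /=;
  rewrite ?count_map; lia.

Section Translation.

Variable X : calculus.
Local Notation der := (signed_derivable X).

Definition sound (R : rule) (st : modal_step) : Prop :=
  forall ps c, R ps c -> (forall p, p \in ps -> der (encode p)) ->
  exists P Q C, st der P Q /\ perm_eq (encode c) (boxed_sequent P Q ++ C).

Lemma sound_or R1 R2 st1 st2 :
  sound R1 st1 -> sound R2 st2 -> sound (R1 ⊕ R2) (step_or st1 st2).
Proof.
move=> h1 h2 ps c [/h1 h|/h2 h] /h [P [Q [C [st e]]]]; exists P, Q, C; split=> //.
  by left.
by right.
Qed.

Lemma sound_modal_rules : sound (modal_rules X) (step X).
Proof.
have prem0 p ps (h : forall q, q \in p :: ps -> der (encode q)) :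
  der (encode p) := h p (mem_head _ _).
have prem1 p q ps (h : forall r, r \in [:: p, q & ps] -> der (encode r)) :
  der (encode q) by apply: h; rewrite !inE eqxx orbT.
have seq1 A B :
    der (encode ([mset A] ⇒ [mset B])) -> der (signed_sequent [:: A] [:: B]).
  by apply: der_perm; mset_count.
have seqK (P : {mset formula}) B :
    der (encode (P ⇒ [mset B])) -> der (signed_sequent P [:: B]).
  by apply: der_perm; mset_count.
have seqD (P : {mset formula}) :
    der (encode (P ⇒ mset0)) -> der (signed_sequent P [::]).
  by apply: der_perm; rewrite /encode /= enum_mset0.
have sE : sound LR_E (step_C (pred1 1)).
  move=> _ _ [A B G D] h; exists [:: A], [:: B], (signed_sequent G D).
  split; last by mset_count.
  constructor=> //; first exact: seq1 (prem0 _ _ h).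
  by move=> A'; rewrite inE => /eqP->; exact: seq1 (prem1 _ _ _ h).
have sM : sound LR_M (step_K (pred1 1)).
  move=> _ _ [A B G D] h; exists [:: A], [:: B], (signed_sequent G D).
  split; last by mset_count.
  by constructor=> //; exact: seq1 (prem0 _ _ h).
have sR : sound LR_R (step_K (leq 1)).
  move=> _ _ [A P B G D] h; exists (A :: P), [:: B], (signed_sequent G D).
  split; last by mset_count.
  by constructor=> //; apply: der_perm (prem0 _ _ h); mset_count.
have sC : sound LR_C (step_C (leq 1)).
  move=> _ _ [P B G D sP] h; exists P, [:: B], (signed_sequent G D).
  split; last by mset_count.
  constructor=> //; first exact: seqK (prem0 _ _ h).
  by move=> A AP; apply/seq1/h; rewrite inE; apply/orP; right; apply/mapP; exists A.
have sK : sound LR_K (step_K predT).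
  move=> _ _ [P B G D] h; exists P, [:: B], (signed_sequent G D).
  split; last by mset_count.
  by constructor=> //; exact: seqK (prem0 _ _ h).
have sN : sound R_N (step_K (pred1 0)).
  move=> _ _ [B G D] h; exists [::], [:: B], (signed_sequent G D).
  split; last by mset_count.
  by constructor=> //; apply: der_perm (prem0 _ _ h); mset_count.
have sDb : sound L_D_bot (step_D (pred1 1)).
  move=> _ _ [A G D] h; exists [:: A], [::], (signed_sequent G D).
  split; last by mset_count.
  by constructor=> //; apply: der_perm (prem0 _ _ h); mset_count.
have sDE : sound L_D_diaE step_diaE.
  move=> _ _ [P G D sP] h; exists P, [::], (signed_sequent G D).
  split; last by mset_count.
  constructor=> //; first exact: seqD (prem0 _ _ h).
  by apply: der_perm (prem1 _ _ _ h); mset_count.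
have sDM : sound L_D_diaM (step_D (geq 2)).
  move=> _ _ [P G D sP] h; exists P, [::], (signed_sequent G D).
  split; last by mset_count.
  by constructor=> //; exact: seqD (prem0 _ _ h).
have sDC : sound L_D_diaC step_diaC.
  move=> _ _ [P S G D] h; exists (P ++ S), [::], (signed_sequent G D).
  split; last by mset_count.
  apply: (Step_diaC (perm_refl _)); first by apply: der_perm (prem0 _ _ h); mset_count.
  move=> A B AP BS; apply: (@der_perm _ (encode (mset0 ⇒ [mset A; B]))).
    by mset_count.
  by apply: h; rewrite inE; apply/orP; right; apply: allpairs_f.
have sDs : sound L_D_star (step_D predT).
  move=> _ _ [P G D] h; exists P, [::], (signed_sequent G D).
  split; last by mset_count.
  by constructor=> //; exact: seqD (prem0 _ _ h).
by case: X => /=; repeat apply: sound_or.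
Qed.

Lemma derivable_encode c : derivable X c -> der (encode c).
Proof.
elim=> {c} ps c [hcp|hm] _ IH; last first.
  have [P [Q [C [st e]]]] := sound_modal_rules hm IH.
  by apply: der_perm (der_step C st); rewrite perm_sym.
have prop s L C E : premisses s = Some L -> perm_eq E (s :: C) ->
    (forall a, a \in L -> exists2 p, p \in ps & perm_eq (encode p) (a ++ C)) ->
    der E.
  move=> hs e h; apply: (der_prop hs e) => a /h[p /IH dp ep].
  exact: der_perm ep dp.
case: hcp prop {IH} => [n G D|G D|A B G D|A B G D|A B G D|A B G D|A B G D|A B G D] prop.
- apply: (@der_perm _ [:: (true, Var n), (false, Var n) & signed_sequent G D]).
    by mset_count.
  by apply: (@der_ax _ n); rewrite !inE eqxx ?orbT.
- by apply: (@prop (true, Bot) _ (signed_sequent G D) _ erefl); [mset_count|].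
- apply: (@prop (true, And A B) _ (signed_sequent G D) _ erefl); first by mset_count.
  move=> a; rewrite !inE => /eqP->; eexists; first exact: mem_head.
  by mset_count.
- apply: (@prop (false, And A B) _ (signed_sequent G D) _ erefl); first by mset_count.
  move=> a; rewrite !inE => /orP[] /eqP->.
    by exists (G ⇒ D `+` [mset A]); [apply: mem_head | mset_count].
  by exists (G ⇒ D `+` [mset B]); [rewrite !inE eqxx orbT | mset_count].
- apply: (@prop (true, Or A B) _ (signed_sequent G D) _ erefl); first by mset_count.
  move=> a; rewrite !inE => /orP[] /eqP->.
    by exists (A +` G ⇒ D); [apply: mem_head | mset_count].
  by exists (B +` G ⇒ D); [rewrite !inE eqxx orbT | mset_count].
- apply: (@prop (false, Or A B) _ (signed_sequent G D) _ erefl); first by mset_count.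
  move=> a; rewrite !inE => /eqP->; eexists; first exact: mem_head.
  by mset_count.
- apply: (@prop (true, Imp A B) _ (signed_sequent G D) _ erefl); first by mset_count.
  move=> a; rewrite !inE => /orP[] /eqP->.
    by exists (G ⇒ D `+` [mset A]); [apply: mem_head | mset_count].
  by exists (B +` G ⇒ D); [rewrite !inE eqxx orbT | mset_count].
- apply: (@prop (false, Imp A B) _ (signed_sequent G D) _ erefl); first by mset_count.
  move=> a; rewrite !inE => /eqP->; eexists; first exact: mem_head.
  by mset_count.
Qed.

Lemma decode_perm C E : perm_eq C E -> decode C = decode E.
Proof.
by move=> e; congr (_, _); apply/eq_seq_msetP/perm_map/perm_filter.
Qed.

Lemma decode_cons b A C : decode ((b, A) :: C) =
  if b then (A +` (decode C).1 ⇒ (decode C).2)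
  else ((decode C).1 ⇒ (decode C).2 `+` [mset A]).
Proof. by case: b; rewrite /decode /= mset_cons // msetDC. Qed.

Lemma seq_mset_nil : seq_mset [::] = mset0 :> {mset formula}.
Proof. by apply/msetP => A; rewrite mset_seqE mset0E. Qed.

Lemma seq_mset1 A : seq_mset [:: A] = [mset A].
Proof. by rewrite mset_cons seq_mset_nil msetD0. Qed.

Lemma decode_signed_sequent_cat P Q C : decode (signed_sequent P Q ++ C) =
  (seq_mset P `+` (decode C).1 ⇒ (decode C).2 `+` seq_mset Q).
Proof.
elim: P => [|A P IH]; last by rewrite /= decode_cons IH /= mset_cons msetDA.
elim: Q => [|A Q IH]; rewrite /= ?seq_mset_nil ?mset_cons.
  by rewrite [mset0 `+` _]msetDC !msetD0.
by rewrite decode_cons [decode _]IH /= seq_mset_nil [[mset A] `+` _]msetDC msetDA.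
Qed.

Lemma decode_signed_sequent P Q :
  decode (signed_sequent P Q) = (seq_mset P ⇒ seq_mset Q).
Proof.
rewrite -[signed_sequent P Q]cats0 decode_signed_sequent_cat /decode /=.
by rewrite seq_mset_nil msetD0 msetDC msetD0.
Qed.

Lemma boxes_seq_mset P : boxes (seq_mset P) = seq_mset (map Box P).
Proof. by apply/eq_seq_msetP/perm_map/perm_eq_seq_mset. Qed.

Definition complete (st : modal_step) (R : rule) : Prop :=
  forall d P Q G D, (forall x, d x -> derivable X (decode x)) -> st d P Q ->
  exists2 ps, R ps (seq_mset (map Box P) `+` G ⇒ D `+` seq_mset (map Box Q))
    & forall p, p \in ps -> derivable X p.

Lemma complete_or st1 st2 R1 R2 :
  complete st1 R1 -> complete st2 R2 -> complete (step_or st1 st2) (R1 ⊕ R2).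
Proof.
move=> h1 h2 d P Q G D hd [/(h1 _ _ _ G D hd)|/(h2 _ _ _ G D hd)] [ps Rps dps].
  by exists ps => //; left.
by exists ps => //; right.
Qed.

Lemma complete_step : complete (step X) (modal_rules X).
Proof.
have dec d P Q : (forall x, d x -> derivable X (decode x)) ->
    d (signed_sequent P Q) -> derivable X (seq_mset P ⇒ seq_mset Q).
  by move=> hd /hd; rewrite decode_signed_sequent.
have size1 P : pred1 1 (size P) -> exists A, P = [:: A].
  by case: P => [|A []] // _; exists A.
have cE : complete (step_C (pred1 1)) LR_E.
  move=> d _ _ G D /dec {}dec [P B /size1[A ->] /dec dAB dBA].
  rewrite /= !seq_mset1 in dAB *; eexists; first exact: LR_E_inst.
  move=> p; rewrite !inE => /orP[] /eqP-> //.
  by have := dec _ _ (dBA A (mem_head _ _)); rewrite !seq_mset1.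
have cM : complete (step_K (pred1 1)) LR_M.
  move=> d _ _ G D /dec {}dec [P B /size1[A ->] /dec dAB].
  rewrite /= !seq_mset1 in dAB *; eexists; first exact: LR_M_inst.
  by move=> p; rewrite !inE => /eqP->.
have cR : complete (step_K (leq 1)) LR_R.
  move=> d _ _ G D /dec {}dec [[|A P] // B _ /dec].
  rewrite /= !seq_mset1 !mset_cons -msetDA -boxes_seq_mset => dAB.
  eexists; first exact: LR_R_inst.
  by move=> p; rewrite !inE => /eqP->.
have cC : complete (step_C (leq 1)) LR_C.
  move=> d _ _ G D /dec {}dec [P B sP /dec dP dB].
  rewrite /= !seq_mset1 -boxes_seq_mset in dP *; eexists.
    by apply: LR_C_inst; rewrite (perm_size (perm_eq_seq_mset P)).
  move=> p; rewrite inE => /predU1P[->//|/mapP[A]].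
  rewrite (perm_mem (perm_eq_seq_mset P)) => /dB /dec + ->.
  by rewrite !seq_mset1.
have cK : complete (step_K predT) LR_K.
  move=> d _ _ G D /dec {}dec [P B _ /dec dP].
  rewrite /= !seq_mset1 -boxes_seq_mset in dP *; eexists; first exact: LR_K_inst.
  by move=> p; rewrite !inE => /eqP->.
have cN : complete (step_K (pred1 0)) R_N.
  move=> d _ _ G D /dec {}dec [[|//] B _ /dec dP].
  rewrite /= !seq_mset1 seq_mset_nil [mset0 `+` _]msetDC msetD0 in dP *.
  eexists; first exact: R_N_inst.
  by move=> p; rewrite !inE => /eqP->.
have cDb : complete (step_D (pred1 1)) L_D_bot.
  move=> d _ _ G D /dec {}dec [P /size1[A ->] /dec dP].
  rewrite /= !seq_mset1 seq_mset_nil msetD0 in dP *.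
  eexists; first exact: L_D_bot_inst.
  by move=> p; rewrite !inE => /eqP->.
have cDE : complete step_diaE L_D_diaE.
  move=> d _ _ G D /dec {}dec [P sP /dec dP /dec dP'].
  rewrite /= -boxes_seq_mset seq_mset_nil msetD0 in dP dP' *; eexists.
    by apply: L_D_diaE_inst; rewrite (perm_size (perm_eq_seq_mset P)).
  by move=> p; rewrite !inE => /orP[] /eqP->.
have cDM : complete (step_D (geq 2)) L_D_diaM.
  move=> d _ _ G D /dec {}dec [P sP /dec dP].
  rewrite /= -boxes_seq_mset seq_mset_nil msetD0 in dP *; eexists.
    by apply: L_D_diaM_inst; rewrite (perm_size (perm_eq_seq_mset P)).
  by move=> p; rewrite !inE => /eqP->.
have cDC : complete step_diaC L_D_diaC.
  move=> d _ _ G D /dec {}dec [P P1 P2 e /dec dP dP12].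
  have mset_cat (s1 s2 : seq formula) :
      seq_mset (s1 ++ s2) = seq_mset s1 `+` seq_mset s2.
    by apply/msetP => A; rewrite msetE2 !mset_seqE count_cat.
  have eP : seq_mset (map Box P) = boxes (seq_mset P1) `+` boxes (seq_mset P2).
    by rewrite !boxes_seq_mset -mset_cat -map_cat; apply/eq_seq_msetP/perm_map.
  move/eq_seq_msetP: e dP => -> dP.
  rewrite /= eP mset_cat seq_mset_nil msetD0 -msetDA in dP *.
  eexists; first exact: L_D_diaC_inst.
  move=> p; rewrite inE => /predU1P[->//|/allpairsP[[A B] /=]].
  rewrite !(perm_mem (perm_eq_seq_mset _)) => -[AP BP ->].
  by have := dec _ _ (dP12 _ _ AP BP); rewrite seq_mset_nil mset_cons seq_mset1.
have cDs : complete (step_D predT) L_D_star.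
  move=> d _ _ G D /dec {}dec [P _ /dec dP].
  rewrite /= -boxes_seq_mset seq_mset_nil msetD0 in dP *; eexists.
    exact: L_D_star_inst.
  by move=> p; rewrite !inE => /eqP->.
by case: X => /=; repeat apply: complete_or.
Qed.

Lemma derivable_decode E : der E -> derivable X (decode E).
Proof.
elim=> {E} [n E hT hF | s L C E hs eE _ IH | d P Q C E _ IH st eE].
- have hF' : (false, Var n) \in rem (true, Var n) E.
    have := hF; rewrite (perm_mem (perm_to_rem hT)) inE => /predU1P[//|].
    exact.
  rewrite (decode_perm (perm_to_rem hT)) decode_cons.
  rewrite (decode_perm (perm_to_rem hF')) decode_cons.
  by apply: (@derivable_rule _ [::]) => //; left; apply: Init.
- rewrite (decode_perm eE).
  have {}IH a : a \in L -> derivable X (decode (a ++ C)) by apply: IH.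
  have rl ps c : G3cp ps c -> (forall p, p \in ps -> derivable X p) -> derivable X c.
    by move=> hc; apply: derivable_rule; left.
  case: s hs eE => [[] []] //= => [|A B|A B|A B|A B|A B|A B] [eL] _;
    rewrite decode_cons; move: IH; rewrite -{L}eL => IH.
  + by apply: rl (L_bot _ _) _.
  + apply: rl (L_and _ _ _ _) _ => p; rewrite inE => /eqP->.
    by have := IH _ (mem_head _ _); rewrite /= !decode_cons.
  + apply: rl (L_or _ _ _ _) _ => p; rewrite !inE => /orP[] /eqP->.
      by have := IH [:: (true, A)]; rewrite /= decode_cons; apply; rewrite !inE eqxx.
    by have := IH [:: (true, B)]; rewrite /= decode_cons; apply; rewrite !inE eqxx orbT.
  + apply: rl (L_imp _ _ _ _) _ => p; rewrite !inE => /orP[] /eqP->.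
      by have := IH [:: (false, A)]; rewrite /= decode_cons; apply; rewrite !inE eqxx.
    by have := IH [:: (true, B)]; rewrite /= decode_cons; apply; rewrite !inE eqxx orbT.
  + apply: rl (R_and _ _ _ _) _ => p; rewrite !inE => /orP[] /eqP->.
      by have := IH [:: (false, A)]; rewrite /= decode_cons; apply; rewrite !inE eqxx.
    by have := IH [:: (false, B)]; rewrite /= decode_cons; apply; rewrite !inE eqxx orbT.
  + apply: rl (R_or _ _ _ _) _ => p; rewrite inE => /eqP->.
    by have := IH _ (mem_head _ _); rewrite /= !decode_cons /= msetDAC.
  + apply: rl (R_imp _ _ _ _) _ => p; rewrite inE => /eqP->.
    by have := IH _ (mem_head _ _); rewrite /= !decode_cons.
- rewrite (decode_perm eE) decode_signed_sequent_cat.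
  have [ps Rps dps] := complete_step (decode C).1 (decode C).2 IH st.
  by apply: derivable_rule dps; right.
Qed.

Lemma decode_encode c : decode (encode c) = c.
Proof. by case: c => G D; rewrite decode_signed_sequent !seq_mset_id. Qed.

End Translation.

Theorem theorem4 (X : calculus) (D : formula) (Gamma Delta Pi Sigma : {mset formula}) :
  derivable X (Gamma ⇒ Delta `+` [mset D]) ->
  derivable X (D +` Pi ⇒ Sigma) ->
  derivable X (Gamma `+` Pi ⇒ Delta `+` Sigma).
Proof.
move=> /derivable_encode dF /derivable_encode dT.
rewrite -[_ ⇒ _]decode_encode; apply/derivable_decode/(@der_cut _ D).
  by apply: der_perm (der_weaken (signed_sequent Gamma Delta) dT); mset_count.
by apply: der_perm (der_weaken (signed_sequent Pi Sigma) dF); mset_count.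
Qed.
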